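(* For $p\in(0,1)$ let $\Psi_p(t):=\min\{t/p,1\}$, and let $\Psi_0(t):=\mathbf{1}_{t>0}$, $t\in[0,1]$. Then, as $p\to0$, in the weak-* topology of $L^\infty(\mathcal{X};\nu)$, $\mathrm{ProbPer}_{\Psi_p}$ $\Gamma$-converges to $\mathrm{ProbPer}_{\Psi_0}$ and $\mathrm{ProbR}_{\Psi_p}$ $\Gamma$-converges to $\mathrm{ProbR}_{\Psi_0}$.
   Context: Setting: $\mathcal{X}$ is a set, $\mathcal{A}\subset 2^{\mathcal{X}}$ a $\sigma$-algebra, and $\mu$ a probability measure on $(\mathcal{X}\times\{0,1\},\mathcal{A}\otimes 2^{\{0,1\}})$. For $i\in\{0,1\}$ put $\rho_i(B):=\mu(B\times\{i\})$, and $\rho:=\rho_0+\rho_1$. $\{\mathfrak{m}_x\}_{x\in\mathcal{X}}$ is a family such that $\mathfrak{m}_x$ is a probability measure on $(\mathcal{X},\mathcal{A})$ for $\rho$-almost every $x$, and $x\mapsto\mathfrak{m}_x(B)$ is measurable for every $B\in\mathcal{A}$. Define $\nu(B):=\frac12\int_{\mathcal{X}}\mathfrak{m}_x(B)\,d\rho(x)+\frac12\rho(B)$. For $A\in\mathcal{A}$: $$\mathrm{ProbPer}_\Psi(A):=\int_{A^c}\Psi(\mathfrak{m}_x(A))\,d\rho_0(x)+\int_{A}\Psi(\mathfrak{m}_x(A^c))\,d\rho_1(x),$$ $$\mathrm{ProbR}_\Psi(A):=\rho_0(A)+\rho_1(A^c)+\mathrm{ProbPer}_\Psi(A).$$ Functionals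 of sets $A\in\mathcal{A}$ are regarded as functionals on $\{\mathbf{1}_A:A\in\mathcal{A}\}\subset L^\infty(\mathcal{X};\nu)$ with the weak-* topology (convergence of integrals against every $\varphi\in L^1(\mathcal{X};\nu)$). $F_p$ $\Gamma$-converges to $F$ as $p\to0$ if for every sequence $p_n\to0$ in $(0,1)$: (i) whenever $\mathbf{1}_{A_n}\to\mathbf{1}_A$ one has $\liminf_n F_{p_n}(A_n)\ge F(A)$; (ii) for every $A$ there is a sequence with $\mathbf{1}_{A_n}\to\mathbf{1}_A$ and $\limsup_n F_{p_n}(A_n)\le F(A)$. *)

(* Defs.v *)
From HB Require Import structures.
From mathcomp Require Import all_boot all_order all_algebra.
From mathcomp Require Import all_classical all_reals all_analysis.
From mathcomp Require Import measurable_realfun.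

Set Implicit Arguments.
Unset Strict Implicit.
Unset Printing Implicit Defensive.

Import Order.TTheory GRing.Theory Num.Theory numFieldNormedType.Exports.
Local Open Scope classical_set_scope.
Local Open Scope ring_scope.
Local Open Scope ereal_scope.

(* The label set {0, 1} is [bool] (0 = false, 1 = true), whose sigma-algebra
   is the discrete one. *)
Section class_measures.
Context d (X : measurableType d) (R : realType).
Variable mu : probability (X * bool)%type R.

Definition rho_ (i : bool) (B : set X) : \bar R := mu (B `*` [set i]).

Section rho_measure.
Variable i : bool.

Let rho0 : rho_ i set0 = 0.
Proof. by rewrite /rho_ set0X measure0. Qed.

Let rho_ge0 B : 0 <= rho_ i B.
Proof. exact: measure_ge0. Qed.

Let rho_sigma_additive : semi_sigma_additive (rho_ i).
Proof.
move=> F mF tF mUF; rewrite /rho_.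
rewrite (_ : _ `*` _ = \bigcup_n (F n `*` [set i])); last first.
  by rewrite setX_bigcupl.
apply: measure_sigma_additive; first by move=> n; exact: measurableX.
move=> j k _ _ [[x b] [[Fjx _] [Fkx _]]].
by apply: tF => //; exists x.
Qed.

HB.instance Definition _ :=
  isMeasure.Build _ _ _ (rho_ i) rho0 rho_ge0 rho_sigma_additive.

End rho_measure.

Definition rho : {measure set X -> \bar R} :=
  measure_add (rho_ false) (rho_ true).

End class_measures.

(* A set function is only constrained on the sigma-algebra. *)
Definition is_probability_measure d (X : measurableType d) (R : realType)
    (m : set X -> \bar R) : Prop :=
  exists P : probability X R, forall B, measurable B -> m B = P B.

(* The measures m x need only exist for rho-almost every x. *)
Definition ae_probability_family d (X : measurableType d) (R : realType)
    (mu : probability (X * bool)%type R) (m : X -> set X -> \bar R) : Prop :=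
  {ae rho mu, forall x, is_probability_measure (m x)} /\
  (forall B, measurable B -> measurable_fun [set: X] (m ^~ B)).

Section functionals.
Context d (X : measurableType d) (R : realType).
Variables (mu : probability (X * bool)%type R) (m : X -> set X -> \bar R).

(* Integration against [nu] only involves its values on measurable sets, where
   it is a measure as soon as [ae_probability_family mu m] holds. *)
Definition nu (B : set X) : \bar R :=
  2^-1%:E * (\int[rho mu]_x m x B) + 2^-1%:E * rho mu B.

(* [fine] is harmless: m x A lies in [0, 1] for rho-almost every x. *)
Definition ProbPer (Psi : R -> R) (A : set X) : \bar R :=
  \int[rho_ mu false]_(x in ~` A) (Psi (fine (m x A)))%:E +
  \int[rho_ mu true]_(x in A) (Psi (fine (m x (~` A))))%:E.

Definition ProbR (Psi : R -> R) (A : set X) : \bar R :=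
  rho_ mu false A + rho_ mu true (~` A) + ProbPer Psi A.

End functionals.

Section gamma_convergence.
Context d (X : measurableType d) (R : realType).
Variable nu : set X -> \bar R.

(* Weak-* convergence in L^oo(nu), for (bounded measurable) representatives. *)
Definition weakstar_cvg (f_ : nat -> X -> R) (f : X -> R) : Prop :=
  forall phi : X -> R, nu.-integrable setT (fun x => (phi x)%:E) ->
    (fun n => \int[nu]_x (f_ n x * phi x)%:E) @ \oo -->
      \int[nu]_x (f x * phi x)%:E.

Definition gamma_cvg0 (F : R -> set X -> \bar R) (F0 : set X -> \bar R) : Prop :=
  forall p : nat -> R, (forall n, (0 < p n < 1)%R) -> p @ \oo --> (0 : R)%R ->
    (forall (A_ : nat -> set X) (A : set X),
      (forall n, measurable (A_ n)) -> measurable A ->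
      weakstar_cvg (fun n => \1_(A_ n)) (\1_A) ->
      F0 A <= limn_einf (fun n => F (p n) (A_ n))) /\
    (forall A : set X, measurable A ->
      exists A_ : nat -> set X,
        [/\ forall n, measurable (A_ n),
            weakstar_cvg (fun n => \1_(A_ n)) (\1_A) &
            limn_esup (fun n => F (p n) (A_ n)) <= F0 A]).

End gamma_convergence.

Definition Psi_ (R : realType) (p t : R) : R := Num.min (t / p)%R 1%R.

Definition Psi0 (R : realType) (t : R) : R := ((0 < t)%R)%:R%R.

(* Main.v *)
(* Weak-* convergence of 1_(A_n) to an indicator 1_A forces nu (A_n + A) -> 0
   (symmetric difference), hence A_n -> A in L^1(rho) and m_x(A_n) -> m_x(A) in
   L^1(rho). As Psi_q is 1/q-Lipschitz, ProbPer for Psi_q is continuous along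
   such sequences, and it increases to ProbPer for Psi_0 as q decreases to 0 by
   monotone convergence. An increasing limit of continuous functionals is a
   Gamma-limit. *)
Require Import Defs.
From HB Require Import structures.
From mathcomp Require Import all_boot all_order all_algebra.
From mathcomp Require Import all_classical all_reals all_analysis.
From mathcomp Require Import measurable_realfun.
From mathcomp Require Import lra.

Set Implicit Arguments.
Unset Strict Implicit.
Unset Printing Implicit Defensive.

Import Order.TTheory GRing.Theory Num.Theory numFieldNormedType.Exports.
Local Open Scope classical_set_scope.
Local Open Scope ring_scope.
Local Open Scope ereal_scope.

(** * Set functions that agree on the measurable sets *)

Section set_function_integral.
Import HBNNSimple.
Context d (X : measurableType d) (R : realType).
Variables m1 m2 : set X -> \bar R.
Hypothesis m12 : forall B, measurable B -> m1 B = m2 B.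

(** The integral is built from suprema of integrals of simple functions, which evaluate the set
    function only on measurable level sets. This lets the bare set function [nu] be exchanged for a
    bundled measure. *)
Lemma eq_set_function_integral (f : X -> \bar R) :
  \int[m1]_x f x = \int[m2]_x f x.
Proof.
have s12 (h : {nnsfun X >-> R}) : sintegral m1 h = sintegral m2 h.
  by apply: eq_fsbigr => r _; rewrite m12.
rewrite /integral.
by congr (ereal_sup _ - ereal_sup _); apply: eq_imagel => h _; exact: s12.
Qed.

Lemma eq_weakstar_cvg (f_ : nat -> X -> R) (f : X -> R) :
  weakstar_cvg m1 f_ f -> weakstar_cvg m2 f_ f.
Proof.
move=> fm phi iphi.
rewrite -(eq_set_function_integral (fun x => (f x * phi x)%:E)).
have -> : (fun n => \int[m2]_x (f_ n x * phi x)%:E) =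
    (fun n => \int[m1]_x (f_ n x * phi x)%:E).
  by apply/funext => n; rewrite eq_set_function_integral.
apply: fm; move: iphi => /integrableP[mphi iphi].
by apply/integrableP; split => //; rewrite eq_set_function_integral.
Qed.

End set_function_integral.

(** Used to pass from a family of genuine probability measures back to the given family, which is
    one only almost everywhere. *)
Lemma eq_gamma_cvg0 d (X : measurableType d) (R : realType)
    (m1 m2 : set X -> \bar R) (F G : R -> set X -> \bar R)
    (F0 G0 : set X -> \bar R) :
  (forall B, measurable B -> m1 B = m2 B) ->
  (forall p A, (0 < p)%R -> measurable A -> F p A = G p A) ->
  (forall A, measurable A -> F0 A = G0 A) ->
  gamma_cvg0 m1 F F0 -> gamma_cvg0 m2 G G0.
Proof.
move=> m12 FG FG0 H p p01 pcvg; have [H1 H2] := H p p01 pcvg.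
have p0 n : (0 < p n)%R by have /andP[] := p01 n.
split=> [A_ A mA_ mA cA|A mA].
  rewrite -FG0//; under eq_fun do rewrite -FG//.
  by apply: H1 => //; apply: eq_weakstar_cvg cA => B mB; rewrite m12.
have [A_ [mA_ cA le]] := H2 A mA.
exists A_; split => //; first exact: eq_weakstar_cvg cA.
by rewrite -FG0//; under eq_fun do rewrite -FG//.
Qed.

(** * Weak-* convergence of indicators and an abstract Gamma-convergence criterion *)

(* Testing against 1_A and 1_(~A): for indicators, weak-* convergence to an
   indicator is convergence in L^1. *)
Lemma weakstar_cvg_setY d (X : measurableType d) (R : realType)
    (M : {measure set X -> \bar R}) (A_ : nat -> set X) (A : set X) :
  M setT < +oo -> (forall n, measurable (A_ n)) -> measurable A ->
  weakstar_cvg M (fun n => \1_(A_ n)) (\1_A) ->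
  M (A `+` A_ n) @[n --> \oo] --> 0.
Proof.
move=> Mfin mA_ mA cA.
have finM B : measurable B -> M B < +oo.
  by move=> mB; apply: le_lt_trans Mfin; apply: le_measure; rewrite ?inE.
have intB B : measurable B -> M.-integrable setT (fun x => (\1_B x : R)%:E).
  move=> mB; apply/integrableP; split.
    exact/measurable_EFinP/measurable_indic.
  under eq_integral do rewrite gee0_abs//.
  by rewrite integral_indic// setIT finM.
have intM C B : measurable C -> measurable B ->
    \int[M]_x (\1_C x * \1_B x : R)%:E = M (C `&` B).
  move=> mC mB; have := integral_indic M measurableT (measurableI _ _ mC mB).
  by rewrite setIT indicI.
have test B : measurable B -> M (A_ n `&` B) @[n --> \oo] --> M (A `&` B).
  move=> mB; have := cA _ (intB _ mB); rewrite intM//.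
  by under eq_fun do rewrite intM//.
(* In this form each term is constant or an integral of [\1_(A_ n)] against an integrable indicator,
   so the limit can be taken term by term. Finiteness of [M] justifies the subtraction. *)
have -> : (fun n => M (A `+` A_ n)) =
    (fun n => M A - M (A_ n `&` A) + M (A_ n `&` ~` A)).
  apply/funext => n; rewrite setY_def measureU//; last 3 first.
  - exact: measurableD.
  - exact: measurableD.
  - by apply/seteqP; split => // x [[? ?] []].
  rewrite measureD//; last exact: finM.
  by rewrite (setIC A) setDE.
have finA : M A \is a fin_num by rewrite ge0_fin_numE// finM.
have -> : 0 = M A - M (A `&` A) + M (A `&` ~` A).
  by rewrite setIid setICr measure0 adde0 subee.
apply: cvgeD; last exact: test (measurableC mA).
  by rewrite setICr measure0 fin_num_adde_defl.
apply: cvgeB; [by rewrite fin_num_adde_defr|exact: cvg_cst|exact: test].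
Qed.

Lemma le_limn_einf_cvg (R : realType) (u v : (\bar R)^nat) (l : \bar R) :
  u @ \oo --> l -> (\forall n \near \oo, u n <= v n) -> l <= limn_einf v.
Proof.
move=> ul [N _ uv]; have [<- _] := cvg_limn_einf_sup ul.
rewrite !limn_einf_lim; apply: lee_lim; [exact: is_cvg_einfs..|].
exists N => // n /= Nn; apply: le_ereal_inf_tmp => _ [k /= nk <-].
apply: le_trans (uv k _); last exact: leq_trans nk.
by apply: ereal_inf_lbound; exists k.
Qed.

(* Each fixed F q with 0 < q < 1 is continuous along the sequence and bounds
   F (p n) from below as soon as p n <= q; the liminf inequality then follows by
   letting q tend to 0, while constant sequences are recovery sequences. *)
Lemma monotone_gamma_cvg0 d (X : measurableType d) (R : realType)
    (M : {measure set X -> \bar R}) (F : R -> set X -> \bar R)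
    (F0 : set X -> \bar R) :
  M setT < +oo ->
  (forall p q A, (0 < p)%R -> (p <= q)%R -> (q < 1)%R -> measurable A ->
    F q A <= F p A) ->
  (forall p A, (0 < p < 1)%R -> measurable A -> F p A <= F0 A) ->
  (forall q, (0 < q < 1)%R -> exists C : R, forall A B,
    measurable A -> measurable B -> F q A <= F q B + C%:E * M (A `+` B)) ->
  (forall A, measurable A -> F (n.+2%:R^-1)%R A @[n --> \oo] --> F0 A) ->
  gamma_cvg0 M F F0.
Proof.
move=> Mfin Fmono FF0 Fmod FcvgF0 p p01 pcvg; split; last first.
  move=> A mA; exists (fun=> A); split => //.
    by move=> phi _; exact: cvg_cst.
  rewrite limn_esup_lim; apply: lime_le; first exact: is_cvg_esups.
  apply: nearW => n; apply: ge_ereal_sup => _ [k /= _ <-].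
  exact: FF0.
move=> A_ A mA_ mA cA.
have YA := weakstar_cvg_setY Mfin mA_ mA cA.
have lsc q : (0 < q < 1)%R -> F q A <= limn_einf (fun n => F (p n) (A_ n)).
  move=> /[dup] q01 /andP[q0 q1]; have [C Fq] := Fmod q q01.
  have fY n : C%:E * M (A `+` A_ n) \is a fin_num.
    rewrite fin_numM// ge0_fin_numE//; apply: le_lt_trans Mfin.
    apply: le_measure; rewrite ?inE// setY_def.
    by apply: measurableU; exact: measurableD.
  (* This lower bound tends to [F q A], because the symmetric differences become negligible. *)
  apply: (@le_limn_einf_cvg _ (fun n => F q A - C%:E * M (A `+` A_ n))).
    rewrite -[X in _ --> X]sube0 -(mule0 C%:E).
    apply: cvgeB; [by rewrite mule0 fin_num_adde_defl|exact: cvg_cst|].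
    exact: cvgeZl.
  near=> n; rewrite leeBlDr//; apply: le_trans (Fq _ _ mA (mA_ n)) _.
  rewrite leeD2r//; have /andP[? ?] := p01 n; apply: Fmono => //.
  by near: n; move: pcvg => /cvgr_le; apply.
have <- := cvg_lim (@ereal_hausdorff _) (FcvgF0 A mA).
apply: lime_le; first by apply/cvg_ex; eexists; exact: FcvgF0.
apply: nearW => n; apply: lsc.
(* The shift by 2 keeps the parameter strictly below 1 already at [n = 0]. *)
by rewrite invr_gt0 ltr0n/= invf_lt1 ?ltr0n// ltr1n.
Unshelve. all: by end_near. Qed.

(** * The truncated linear functions and their pointwise limit *)

Section truncation.
Variable R : realType.
Implicit Types p q s t : R.

Lemma Psi_ge0 p t : (0 < p)%R -> (0 <= t)%R -> (0 <= Psi_ p t)%R.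
Proof. by move=> p0 t0; rewrite le_min ler01 andbT divr_ge0// ltW. Qed.

Lemma Psi_le1 p t : (Psi_ p t <= 1)%R.
Proof. by rewrite ge_min lexx orbT. Qed.

Lemma Psi_le p q t : (0 < p)%R -> (p <= q)%R -> (0 <= t)%R ->
  (Psi_ q t <= Psi_ p t)%R.
Proof.
move=> p0 pq t0; rewrite le_min Psi_le1 andbT ge_min; apply/orP; left.
by rewrite ler_wpM2l// lef_pV2// posrE// (lt_le_trans p0).
Qed.

Lemma Psi_le_Psi0 p t : (0 <= t)%R -> (Psi_ p t <= Psi0 t)%R.
Proof.
rewrite /Psi0 le_eqVlt => /predU1P[<-|->]; last exact: Psi_le1.
by rewrite ltxx /Psi_ mul0r ge_min lexx.
Qed.

(** Monotonicity and the Lipschitz bound in one statement, shaped so that [s <= t + r] can be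
    supplied by subadditivity of a measure. *)
Lemma Psi_lipschitz p s t r : (0 < p)%R -> (0 <= r)%R -> (s <= t + r)%R ->
  (Psi_ p s <= Psi_ p t + p^-1 * r)%R.
Proof.
move=> p0 r0 str; have pr0 : (0 <= p^-1 * r)%R by rewrite mulr_ge0// invr_ge0 ltW.
have : (s / p <= t / p + p^-1 * r)%R.
  by rewrite [(p^-1 * r)%R]mulrC -mulrDl ler_wpM2r// invr_ge0 ltW.
rewrite /Psi_ /Num.min; case: ifPn; case: ifPn; rewrite -?leNgt; lra.
Qed.

(** At [t = 0] every term is 0; for [t > 0] the truncation is active, with value 1, as soon as [n]
    exceeds [t^-1]. *)
Lemma Psi_cvg_Psi0 t : (0 <= t)%R ->
  Psi_ (n.+2%:R^-1)%R t @[n --> \oo] --> Psi0 t.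
Proof.
rewrite /Psi0 le_eqVlt => /predU1P[<-|t0].
  under eq_fun do rewrite /Psi_ mul0r minEle ler01.
  by rewrite ltxx; exact: cvg_cst.
rewrite t0; apply: cvg_near_cst; near=> n.
rewrite /Psi_ invrK minEle ifF//; apply/negbTE; rewrite -ltNge.
rewrite mulrC -ltr_pdivrMr// (@lt_trans _ _ n%:R)//; last by rewrite ltr_nat.
near: n; exact: nbhs_infty_gtr.
Unshelve. all: by end_near. Qed.

Lemma measurable_Psi p : measurable_fun setT (Psi_ p).
Proof.
by apply: measurable_minr; [exact: measurable_funM|exact: measurable_cst].
Qed.

Lemma measurable_Psi0 : measurable_fun setT (@Psi0 R).
Proof.
have -> : @Psi0 R = \1_([set` `]0, +oo[%R]).
  by apply/funext => t; rewrite /Psi0 indicE mem_setE in_itv/= andbT.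
exact: measurable_indic.
Qed.

End truncation.

(** * The average of a probability kernel as a measure *)

Section kernel_average.
Context d (X : measurableType d) (R : realType).
Variables (r : {measure set X -> \bar R}) (k : X -> probability X R).
Hypothesis mk : forall B, measurable B -> measurable_fun [set: X] (k ^~ B).

(* The measurability argument is computationally unused: it lets unification
   find the measure structure below, whose sigma-additivity needs it. *)
Definition kernel_average of
    (forall B, measurable B -> measurable_fun [set: X] (k ^~ B)) :=
  fun B => \int[r]_x k x B.

Let average0 : kernel_average mk set0 = 0.
Proof. by apply: integral0_eq => x _; rewrite measure0. Qed.

Let average_ge0 B : 0 <= kernel_average mk B.
Proof. exact: integral_ge0. Qed.

Let average_sigma_additive : semi_sigma_additive (kernel_average mk).
Proof.
move=> F mF tF mUF; rewrite [X in _ --> X](_ : _ =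
  \int[r]_x (\sum_(n <oo) k x (F n))); last first.
  apply: eq_integral => x _.
  by apply/esym/cvg_lim => //; exact/measure_semi_sigma_additive.
rewrite integral_nneseries//; last by move=> n; exact: mk.
apply/cvg_closeP; split; last by rewrite closeE.
by apply: is_cvg_nneseries => n _ _; exact: integral_ge0.
Qed.

HB.instance Definition _ := isMeasure.Build _ _ _ (kernel_average mk)
  average0 average_ge0 average_sigma_additive.

End kernel_average.

(** * One-label penalties and almost everywhere equal families *)

Section penalty.
Context d (X : measurableType d) (R : realType).
Variables (mu : probability (X * bool)%type R).
Implicit Types (m : X -> set X -> \bar R) (A B : set X) (i : bool).

Lemma rhoE B : rho mu B = rho_ mu false B + rho_ mu true B.
Proof. exact: measure_addE. Qed.

Lemma rho_le1 B : measurable B -> rho mu B <= 1.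
Proof.
move=> mB; rewrite rhoE /rho_ -measureU; last 3 first.
- exact: measurableX.
- exact: measurableX.
- by apply/seteqP; split => // -[x b] [[_ /= ->] [_ /=]].
apply: probability_le1.
by apply: measurableU; exact: measurableX.
Qed.

Lemma rho__le_rho i B : rho_ mu i B <= rho mu B.
Proof.
by rewrite rhoE; case: i; rewrite (leeDl, leeDr).
Qed.

(** Taken at the complement of [A], the same expression gives the second integral of [ProbPer], so
    each estimate is proved once and applied to both labels. *)
Definition penalty m i (Psi : R -> R) A : \bar R :=
  \int[rho_ mu i]_(x in ~` A) (Psi (fine (m x A)))%:E.

Lemma ProbPerE m (Psi : R -> R) A :
  ProbPer mu m Psi A = penalty m false Psi A + penalty m true Psi (~` A).
Proof. by rewrite /penalty setCK. Qed.

(* On the exceptional null set m is replaced by Dirac masses. *)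
Lemma probability_kernel_version m : ae_probability_family mu m ->
  exists2 k : X -> probability X R,
    forall B, measurable B -> measurable_fun [set: X] (k ^~ B) &
    {ae rho mu, forall x, forall B, measurable B -> m x B = k x B}.
Proof.
move=> [[N [mN N0 NP]] mm].
have /choice[k kP] : forall x, exists P : probability X R,
    forall B, measurable B -> P B = if x \in N then \d_x B else m x B.
  move=> x; have [xN|xN] := boolP (x \in N).
    by exists (dirac x).
  have [P mP] : is_probability_measure (m x).
    by apply: contrapT => nP; move: xN; rewrite mem_set//; exact: NP.
  by exists P => B mB; rewrite mP.
exists k => [B mB|].
  (* Both branches are measurable in [x] (the Dirac branch is the indicator of [B]), and so is the
     set [N] that separates them. *)
  rewrite (_ : k ^~ B = fun x => if x \in N then \d_x B else m x B).
    apply: measurable_fun_ifT.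
    - by apply: (measurable_fun_bool true); rewrite setTI preimage_mem_true.
    - exact: measurable_fun_dirac.
    - exact: mm.
  by apply/funext => x; exact: kP.
exists N; split => // x /=; apply: contra_notP => xN B mB.
by rewrite kP// memNset.
Qed.

Lemma measurable_penalty m (Psi : R -> R) A D :
  (forall B, measurable B -> measurable_fun [set: X] (m ^~ B)) ->
  measurable_fun setT Psi -> measurable A ->
  measurable_fun D (fun x => (Psi (fine (m x A)))%:E).
Proof.
move=> mm mPsi mA; apply: measurable_funTS; apply/measurable_EFinP.
apply: measurableT_comp => //.
by apply: (measurableT_comp (fine_measurable measurableT)); exact: mm.
Qed.

Section almost_everywhere_equal.
Variables m1 m2 : X -> set X -> \bar R.
Hypothesis mm1 : forall B, measurable B -> measurable_fun [set: X] (m1 ^~ B).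
Hypothesis mm2 : forall B, measurable B -> measurable_fun [set: X] (m2 ^~ B).
Hypothesis m12 : {ae rho mu, forall x, forall B, measurable B -> m1 x B = m2 x B}.

Lemma eq_nu A : measurable A -> nu mu m1 A = nu mu m2 A.
Proof.
move=> mA; rewrite /nu; congr (_ * _ + _).
apply: ae_eq_integral => //; [exact: mm1|exact: mm2|].
by apply: filterS m12 => x m12x _; exact: m12x.
Qed.

Lemma eq_penalty i (Psi : R -> R) A : measurable_fun setT Psi -> measurable A ->
  penalty m1 i Psi A = penalty m2 i Psi A.
Proof.
move=> mPsi mA; apply: ae_eq_integral; [exact: measurableC|..].
- exact: (measurable_penalty mm1 mPsi mA).
- exact: (measurable_penalty mm2 mPsi mA).
(* The exceptional set is null for [rho], hence for the smaller measure [rho_ mu i]. *)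
have [N [mN N0 NP]] := m12; exists N; split => //.
  by apply/eqP; rewrite -measure_le0 -N0; exact: rho__le_rho.
by apply: subset_trans NP => x /=; apply: contra_not => m12x _; rewrite m12x.
Qed.

Lemma eq_ProbPer (Psi : R -> R) A : measurable_fun setT Psi -> measurable A ->
  ProbPer mu m1 Psi A = ProbPer mu m2 Psi A.
Proof.
by move=> mPsi mA; rewrite !ProbPerE !eq_penalty//; exact: measurableC.
Qed.

End almost_everywhere_equal.
End penalty.

(** * Monotone limits and moduli of continuity for a kernel *)

Section kernel_functionals.
Context d (X : measurableType d) (R : realType).
Variables (mu : probability (X * bool)%type R) (k : X -> probability X R).
Hypothesis mk : forall B, measurable B -> measurable_fun [set: X] (k ^~ B).
Implicit Types (A B : set X) (i : bool) (p q : R).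

Local Notation K := (fun x => k x : set X -> \bar R).

Let fine_ge0 A x : (0 <= fine (k x A))%R.
Proof. by rewrite fine_ge0. Qed.

Let measurable_setY A B : measurable A -> measurable B -> measurable (A `+` B).
Proof.
by move=> mA mB; rewrite setY_def; apply: measurableU; exact: measurableD.
Qed.

Let measurable_Psi_kernel (Psi : R -> R) A D : measurable_fun setT Psi ->
  measurable A -> measurable_fun D (fun x => (Psi (fine (k x A)))%:E).
Proof. by move=> mPsi mA; exact: (measurable_penalty (m := K) mk mPsi mA). Qed.

Lemma le_penalty i (Psi Psi' : R -> R) A :
  measurable_fun setT Psi -> measurable_fun setT Psi' -> measurable A ->
  (forall t, (0 <= t)%R -> (0 <= Psi t <= Psi' t)%R) ->
  penalty mu K i Psi A <= penalty mu K i Psi' A.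
Proof.
move=> mPsi mPsi' mA PsiPsi'; apply: ge0_le_integral.
- exact: measurableC.
- by move=> x _; rewrite lee_fin; have /andP[] := PsiPsi' _ (fine_ge0 A x).
- exact: measurable_Psi_kernel.
- exact: measurable_Psi_kernel.
- by move=> x _; rewrite lee_fin; have /andP[] := PsiPsi' _ (fine_ge0 A x).
Qed.

(** Monotone convergence: the integrands are nonnegative and increase with [n], because the
    truncation parameter decreases. *)
Lemma penalty_Psi_cvg i A : measurable A ->
  penalty mu K i (Psi_ (n.+2%:R^-1)%R) A @[n --> \oo]
  --> penalty mu K i (@Psi0 R) A.
Proof.
move=> mA.
pose g n x := (Psi_ (n.+2%:R^-1)%R (fine (k x A)))%:E.
have -> : penalty mu K i (@Psi0 R) A = \int[rho_ mu i]_(x in ~` A) limn (g ^~ x).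
  apply: eq_integral => x _; apply/esym/cvg_lim => //.
  by apply: cvg_EFin; [exact: nearW|exact: Psi_cvg_Psi0].
apply: cvg_monotone_convergence.
- exact: measurableC.
- by move=> n; apply: measurable_Psi_kernel => //; exact: measurable_Psi.
- move=> n x _; rewrite lee_fin.
  by apply: Psi_ge0; [rewrite invr_gt0|exact: fine_ge0].
- move=> x _ a b ab; rewrite lee_fin.
  apply: Psi_le; [by rewrite invr_gt0| |exact: fine_ge0].
  by rewrite lef_pV2 ?posrE// ler_nat !ltnS.
Qed.

(** The bound is pointwise. On [A] the left integrand vanishes; on [B] outside [A] it is at most 1,
    which the indicator pays for; outside both sets the Lipschitz bound applies, with
    [k x A <= k x B + k x (A]+[B)]. *)
Lemma penalty_Psi_modulus i q A B : (0 < q)%R ->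
  measurable A -> measurable B ->
  penalty mu K i (Psi_ q) A <= penalty mu K i (Psi_ q) B +
    \int[rho_ mu i]_x ((\1_(A `+` B) x)%:E + q^-1%:E * k x (A `+` B)).
Proof.
move=> q0 mA mB; have mY := measurable_setY mA mB.
have Psi_q0 C x : 0 <= (Psi_ q (fine (k x C)))%:E by rewrite lee_fin Psi_ge0.
have Y0 x : 0 <= (\1_(A `+` B) x)%:E + q^-1%:E * k x (A `+` B).
  by rewrite adde_ge0// mule_ge0// lee_fin invr_ge0 ltW.
have mP C : measurable C ->
    measurable_fun setT ((fun x => (Psi_ q (fine (k x C)))%:E) \_ (~` C)).
  move=> mC; apply/(measurable_restrictT _ (measurableC mC)).
  by apply: measurable_Psi_kernel => //; exact: measurable_Psi.
have mYf : measurable_fun setT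
    (fun x => (\1_(A `+` B) x)%:E + q^-1%:E * k x (A `+` B)).
  apply: emeasurable_funD; first exact/measurable_EFinP/measurable_indic.
  by apply: measurable_funeM; exact: mk.
(* The two penalties have different domains; extending the integrands by 0 makes them comparable
   pointwise. *)
rewrite /penalty !(integral_mkcond (~` _)) -ge0_integralD//; last 2 first.
- by move=> x _; apply: erestrict_ge0 => y _; exact: Psi_q0.
- exact: mP.
apply: ge0_le_integral => //.
- by move=> x _; apply: erestrict_ge0 => y _; exact: Psi_q0.
- exact: mP.
- by apply: emeasurable_funD; [exact: mP|exact: mYf].
move=> x _; rewrite !patchE; have [xA|xA] := boolP (x \in ~` A); last first.
  by apply: adde_ge0; [case: ifP => _; [exact: Psi_q0|]|exact: Y0].
have [xB|xB] := boolP (x \in ~` B); last first.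
  rewrite add0e indicE mem_set; last first.
    rewrite setY_def; right; split; last exact: set_mem xA.
    by apply: contrapT => nxB; move: xB; rewrite mem_set.
  apply: (@le_trans _ _ 1); first by rewrite lee_fin Psi_le1.
  by rewrite leeDl// mule_ge0// lee_fin invr_ge0 ltW.
rewrite indicE memNset ?add0e; last first.
  by rewrite setY_def => -[[Ax _]|[Bx _]]; [case: (set_mem xA)|case: (set_mem xB)].
have fk C : measurable C -> (fine (k x C))%:E = k x C.
  by move=> mC; rewrite fineK// fin_num_measure.
rewrite -(fk _ mY) -EFinM -EFinD lee_fin Psi_lipschitz//.
rewrite -lee_fin EFinD !fk//; apply: (@le_trans _ _ (k x (B `|` (A `+` B)))).
  apply: le_measure; rewrite ?inE//; first exact: measurableU.
  move=> y Ay; have [By|nBy] := pselect (B y); first by left.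
  by right; rewrite setY_def; left.
exact: measureU2.
Qed.

(** The set function [nu] of the kernel, reassembled from bundled measures so that monotonicity and
    finiteness arguments apply to it. *)
Definition nu_measure : {measure set X -> \bar R} :=
  measure_add (mscale (2^-1 : R)%R%:nng%R (kernel_average (rho mu) mk))
              (mscale (2^-1 : R)%R%:nng%R (rho mu)).

Lemma nu_measureE B : nu_measure B = nu mu K B.
Proof. exact: measure_addE. Qed.

Lemma double_nu_measure B :
  2%:E * nu_measure B = \int[rho mu]_x k x B + rho mu B.
Proof.
rewrite nu_measureE /nu; set a := \int[_]_x _; set b := rho mu B.
have a0 : 0 <= a by exact: integral_ge0.
have b0 : 0 <= b by exact: measure_ge0.
rewrite (@ge0_muleDr _ _ (2^-1%:E * a) (2^-1%:E * b)) ?mule_ge0 ?lee_fin//.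
by rewrite !muleA -!EFinM divff// !mul1e.
Qed.

Lemma nu_measureT : nu_measure setT < +oo.
Proof.
rewrite nu_measureE /nu; under eq_integral do rewrite probability_setT.
have r1 := rho_le1 mu measurableT.
rewrite integral_cst// mul1e -ge0_muleDr ?measure_ge0//.
rewrite lte_mul_pinfty// lte_add_pinfty//; exact: le_lt_trans r1 (ltry _).
Qed.

(** The errors of the two labels add up to [rho mu Y + q^-1 * \int[rho mu]_x k x Y] with
    [Y = A]+[B]. Since [1 <= q^-1], this is at most [q^-1] times twice the [nu]-mass of [Y], whence
    the constant [2 / q]. *)
Lemma ProbPer_Psi_modulus q A B : (0 < q < 1)%R ->
  measurable A -> measurable B ->
  ProbPer mu K (Psi_ q) A <=
    ProbPer mu K (Psi_ q) B + (2 / q)%:E * nu_measure (A `+` B).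
Proof.
move=> /andP[q0 q1] mA mB; have mY := measurable_setY mA mB.
rewrite !ProbPerE.
(* Both labels thus carry the same error integrand, and their integrals merge into one against
   [rho]. *)
have setYCC : ~` A `+` ~` B = A `+` B.
  by rewrite !setY_def !setDE !setCK setUC (setIC (~` B)) (setIC B).
have := leeD (penalty_Psi_modulus false q0 mA mB)
  (penalty_Psi_modulus true q0 (measurableC mA) (measurableC mB)).
rewrite setYCC => /le_trans; apply.
rewrite addeACA leeD2l//.
have mk1 : measurable_fun setT (fun x => q^-1%:E * k x (A `+` B)).
  by apply: measurable_funeM; exact: mk.
have mi : measurable_fun setT (fun x : X => (\1_(A `+` B) x)%:E : \bar R).
  exact/measurable_EFinP/measurable_indic.
have qk0 x : 0 <= q^-1%:E * k x (A `+` B).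
  by rewrite mule_ge0// lee_fin invr_ge0 ltW.
rewrite -ge0_integral_measure_add//; last 2 first.
- by move=> x _; rewrite adde_ge0.
- exact: emeasurable_funD.
rewrite ge0_integralD// integral_indic// setIT.
rewrite ge0_integralZl//; last 2 first.
- exact: mk.
- by rewrite lee_fin invr_ge0 ltW.
rewrite mulrC EFinM -muleA double_nu_measure (@ge0_muleDr _ _ (integral _ _ _)).
- rewrite addeC leeD2l// -[leLHS]mul1e lee_wpmul2r// lee_fin.
  by rewrite invf_ge1// ltW.
- exact: integral_ge0.
- exact: measure_ge0.
Qed.

(* The additional term [G] is 0 for ProbPer, and the misclassification risk for
   ProbR. *)
Lemma ProbPer_gamma_cvg0 (G : set X -> \bar R) (c : R) :
  (forall A B, measurable A -> measurable B ->
    G A <= G B + c%:E * nu_measure (A `+` B)) ->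
  (forall A, measurable A -> G A \is a fin_num) ->
  gamma_cvg0 nu_measure (fun p A => G A + ProbPer mu K (Psi_ p) A)
    (fun A => G A + ProbPer mu K (@Psi0 R) A).
Proof.
move=> Gmod Gfin; apply: monotone_gamma_cvg0.
- exact: nu_measureT.
- move=> p q A p0 pq q1 mA; have q0 := lt_le_trans p0 pq.
  rewrite leeD2l// !ProbPerE leeD// le_penalty//; try exact: measurable_Psi.
  + by move=> t t0; rewrite Psi_ge0// Psi_le.
  + exact: measurableC.
  + by move=> t t0; rewrite Psi_ge0// Psi_le.
- move=> p A /andP[p0 _] mA; have mC := measurableC mA.
  have mPsi := @measurable_Psi R p; have mPsi0 := @measurable_Psi0 R.
  have le t : (0 <= t)%R -> (0 <= Psi_ p t <= Psi0 t)%R.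
    by move=> t0; rewrite Psi_ge0// Psi_le_Psi0.
  by rewrite leeD2l// !ProbPerE leeD// le_penalty.
- move=> q q01; exists (c + 2 / q)%R => A B mA mB; have /andP[q0 _] := q01.
  (* The real [c] may have any sign, so distributivity in [\bar R] is drawn from the finiteness of
     the measure. *)
  rewrite EFinD muleDl//; last first.
    rewrite ge0_fin_numE//; apply: le_lt_trans nu_measureT.
    by apply: le_measure; rewrite ?inE//; exact: measurable_setY.
  by rewrite addeACA leeD// ?Gmod// ProbPer_Psi_modulus.
- move=> A mA; apply: cvgeD; [|exact: cvg_cst|].
    by rewrite fin_num_adde_defr// Gfin.
  rewrite ProbPerE; under eq_fun do rewrite ProbPerE.
  apply: cvgeD; last exact: penalty_Psi_cvg (measurableC mA).
    by rewrite ge0_adde_def// inE integral_ge0// => x _; rewrite lee_fin /Psi0.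
  exact: penalty_Psi_cvg.
Qed.

(** Subadditivity for each label leaves the error [rho mu (A]+[B)], which is one of the two
    nonnegative terms that make up twice the [nu]-mass. *)
Lemma risk_modulus A B : measurable A -> measurable B ->
  rho_ mu false A + rho_ mu true (~` A) <=
  rho_ mu false B + rho_ mu true (~` B) + 2%:E * nu_measure (A `+` B).
Proof.
move=> mA mB; have mY := measurable_setY mA mB.
have sub i C D : measurable C -> measurable D ->
    C `<=` D `|` (A `+` B) -> rho_ mu i C <= rho_ mu i D + rho_ mu i (A `+` B).
  move=> mC mD CD; apply: le_trans (measureU2 _ mD mY).
  by apply: le_measure; rewrite ?inE//; exact: measurableU.
have sA : A `<=` B `|` (A `+` B).
  move=> y Ay; have [By|nBy] := pselect (B y); first by left.
  by right; rewrite setY_def; left.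
have sC : ~` A `<=` ~` B `|` (A `+` B).
  move=> y Ay; have [By|nBy] := pselect (B y); last by left.
  by right; rewrite setY_def; right.
apply: le_trans (leeD (sub false _ _ mA mB sA)
  (sub true _ _ (measurableC mA) (measurableC mB) sC)) _.
rewrite addeACA leeD2l// -rhoE double_nu_measure leeDr//.
exact: integral_ge0.
Qed.

End kernel_functionals.

(** * Transfer from the kernel version to the given family *)

Theorem proposition8 (R : realType) (d : measure_display) (X : measurableType d)
    (mu : probability (X * bool)%type R) (m : X -> set X -> \bar R)
    (hm : ae_probability_family mu m) :
  gamma_cvg0 (nu mu m) (fun p => ProbPer mu m (Psi_ p))
    (ProbPer mu m (@Psi0 R)) /\
  gamma_cvg0 (nu mu m) (fun p => ProbR mu m (Psi_ p))
    (ProbR mu m (@Psi0 R)).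
Proof.
have [k mk km] := probability_kernel_version hm.
have km' : {ae rho mu, forall x, forall B, measurable B -> k x B = m x B}.
  by apply: filterS km => x kmx B mB; rewrite kmx.
have mm := hm.2.
have nuE B : measurable B -> nu_measure mu mk B = nu mu m B.
  by move=> mB; rewrite nu_measureE; exact: eq_nu.
have PerE p A : measurable A ->
    ProbPer mu (fun x => k x) (Psi_ p) A = ProbPer mu m (Psi_ p) A.
  by move=> mA; apply: eq_ProbPer => //; exact: measurable_Psi.
have Per0E A : measurable A ->
    ProbPer mu (fun x => k x) (@Psi0 R) A = ProbPer mu m (@Psi0 R) A.
  by move=> mA; apply: eq_ProbPer => //; exact: measurable_Psi0.
split.
  apply: (eq_gamma_cvg0 nuE _ _ (@ProbPer_gamma_cvg0 _ _ _ mu k mk (cst 0) 0 _ _)).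
  - by move=> p A _ mA; rewrite add0e PerE.
  - by move=> A mA; rewrite add0e Per0E.
  - by move=> A B mA mB; rewrite mul0e adde0.
  - by [].
(* The constant 2 is the one provided by [risk_modulus]; the risk is finite because [rho] has mass
   at most 1. *)
apply: (eq_gamma_cvg0 nuE _ _ (@ProbPer_gamma_cvg0 _ _ _ mu k mk
  (fun A => rho_ mu false A + rho_ mu true (~` A)) 2 _ _)).
- by move=> p A _ mA; rewrite /ProbR PerE.
- by move=> A mA; rewrite /ProbR Per0E.
- exact: risk_modulus.
- move=> A mA; have fin i B : measurable B -> rho_ mu i B \is a fin_num.
    move=> mB; rewrite ge0_fin_numE//; apply: (@le_lt_trans _ _ 1) (ltry _).
    exact: le_trans (rho__le_rho mu i B) (rho_le1 mu mB).
  by rewrite fin_numD !fin//; exact: measurableC.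
Qed.
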